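(* Let $q\neq 2$ be a power of a prime $p$, let $G$ be $\mathrm{SU}_3(q)$ or $\mathrm{PSU}_3(q)$, and let $\mathcal{C}$ be a conjugacy class of non-trivial unipotent elements (i.e. non-trivial $p$-elements) of $G$. Then $K_{\mathcal{C}}$ is irreducible if and only if $\mathcal{C}$ is not a conjugacy class of involutions. If $\mathcal{C}$ is the class of involutions, then $K_{\mathcal{C}}$ is non-degenerate.
   Context: For a finite group $G$ and a subset $\mathcal{C}\subseteq G\setminus\{1\}$ closed under conjugation, the Killing form $K_{\mathcal{C}}$ is the bilinear form on the complex vector space with basis $\mathcal{C}$ given on basis elements by $K_{\mathcal{C}}(a,b)=|C_G(ab)\cap\mathcal{C}|$; it is non-degenerate if the matrix $(K_{\mathcal{C}}(a,b))_{a,b\in\mathcal{C}}$ is invertible. $K_{\mathcal{C}}$ is irreducible if the graph with vertex set $\mathcal{C}$, in which distinct $a,b$ are adjacent iff $C_G(ab)\cap\mathcal{C}\neq\emptyset$, is connected, and reducible otherwise. *)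

(* Defs.v *)
From HB Require Import structures.
From mathcomp Require Import all_boot all_order all_algebra all_fingroup all_solvable all_field.
Set Implicit Arguments. Unset Strict Implicit. Unset Printing Implicit Defensive.
Import GRing.Theory.
Local Open Scope group_scope.

Definition frobq_mx (F : finFieldType) (q : nat) (A : 'M[F]_3) : 'M[F]_3 :=
  map_mx (fun x => (x ^+ q)%R) A.

(* SU_3(q) realised as { A in SL_3(q^2) | (A^(q))^T A = 1 }, i.e. preserving the
   standard Hermitian form  sum_i x_i^q y_i  on F^3, where #|F| = q^2. *)
Definition SU3 (F : finFieldType) (q : nat) : {set {'GL_3[F]}} :=
  [set g : {'GL_3[F]} |
     (((frobq_mx q (GLval g))^T *m GLval g)%R == 1%:M%R) && (\det (GLval g) == 1)%R].

Definition PSU3 (F : finFieldType) (q : nat) := (SU3 F q / 'Z(SU3 F q))%g.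

Definition killing_mx (gT : finGroupType) (G C : {set gT}) : 'M[algC]_#|C| :=
  \matrix_(i < #|C|, j < #|C|)
     ((#|'C_G[enum_val i * enum_val j] :&: C|)%:R)%R.

Definition killing_nondegenerate (gT : finGroupType) (G C : {set gT}) : Prop :=
  killing_mx G C \in unitmx.

Definition killing_adj (gT : finGroupType) (G C : {set gT}) : rel gT :=
  fun a b => [&& a \in C, b \in C, a != b & 'C_G[a * b] :&: C != set0].

Definition killing_irreducible (gT : finGroupType) (G C : {set gT}) : Prop :=
  forall a b, a \in C -> b \in C -> connect (killing_adj G C) a b.

Definition unipotent_class_claim (gT : finGroupType) (p : nat) (G C : {set gT}) : Prop :=
  C \in classes G ->
  (forall x, x \in C -> (p.-elt x /\ x != 1%g)) ->
  (killing_irreducible G C <-> ~ (forall x, x \in C -> #[x]%g = 2)) /\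
  ((forall x, x \in C -> #[x]%g = 2) -> killing_nondegenerate G C).

(* Main.v *)
Require Import Defs.
From mathcomp Require Import all_boot all_order all_algebra all_fingroup all_solvable all_field.
From mathcomp Require Import ring.

(** Change basis so that the Hermitian form becomes antidiagonal. A non-trivial p-element x fixes
    the isotropic vector spanning the image of the last nonzero power of x - 1, so up to
    conjugation x lies in the stabiliser U of the vector e1.

    If x is not an involution, let S be the stabiliser in G of the connected component of x. It
    contains U, because x and x^u commute for u in U. It also contains some g not fixing the point
    of e1: choose g with g^3 = 1 and (xg)^3 = z commuting with x and g, so that
    x x^(g^-1) x^(g^-2) = z and hence x x^(g^-1) commutes with x^(g^-2). For x regular unipotent one
    takes tr g = tr (xg) = 0, z = 1, which is possible because q <> 2; for x a transvection
    (then p is odd), z is -1 on a hyperbolic plane. Since U and g generate G, S = G.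

    If x is an involution (p = 2), an involution commutes with a product ab of two distinct
    involutions only when all three have the same centre, so the matrix of the form is
    (|C| - m) I + m D with D block diagonal with all-ones blocks of size m < |C|.

    The p-elements of PSU_3(q) lift uniquely along the central p'-kernel, with their commutation
    relations. *)

Set Implicit Arguments. Unset Strict Implicit. Unset Printing Implicit Defensive.
Import GRing.Theory.

(** * Conjugations moving an element to a neighbour in the Killing graph *)

Section GroupLemmas.

Variables (gT : finGroupType).
Local Open Scope group_scope.

(* The hypotheses give x * x^(g^-1) * x^(g^-2) = z. *)
Lemma commute_order3 (x g z : gT) : g ^+ 3 = 1 -> (x * g) ^+ 3 = z ->
  commute z x -> commute z g -> commute (x ^ (g^-1 * g^-1)) (x * x ^ g^-1).
Proof.
move=> g3 xg3 zx zg; set y := x ^ _.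
have zy : commute z y.
  by apply: commuteM; [apply: commuteV | apply: commuteM] => //;
    apply: commuteM => //; apply: commuteV.
suff -> : x * x ^ g^-1 = z * y^-1.
  by apply: commuteM; [apply: commute_sym | apply: commuteV; apply: commute_refl].
have gV : g^-1 * g^-1 = g.
  by apply: (mulgI g); rewrite mulKVg; apply: (mulIg g); rewrite mulVg -g3 !expgS expg0 mulg1 mulgA.
apply: (canRL (mulgK y)); rewrite -xg3 /y gV !conjgE invgK !expgS expg0 mulg1 !mulgA.
by rewrite -(mulgA _ g^-1 g^-1) gV.
Qed.

(** For [x \in G], these are the [g] for which [x ^ g] equals [x] or is adjacent to [x]: when
    [x ^ g = x], the choice [y := x] always works. *)
Definition killing_steps (G : {set gT}) (x : gT) :=
  [set g in G | [exists y in x ^: G, y * (x * x ^ g) == x * x ^ g * y]].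

Lemma killing_stepsP (G : {set gT}) (x g : gT) :
  reflect (g \in G /\ exists2 y, y \in x ^: G & commute y (x * x ^ g))
          (g \in killing_steps G x).
Proof.
rewrite inE; apply: (iffP andP) => -[gG].
  by case/existsP=> y /andP[yx /eqP yg]; split=> //; exists y.
by case=> y yx yg; split=> //; apply/existsP; exists y; rewrite yx; apply/eqP.
Qed.

Lemma order3_gen_killing_steps (G : {group gT}) (x g z : gT) : x \in G -> g \in G ->
  g ^+ 3 = 1 -> (x * g) ^+ 3 = z -> commute z x -> commute z g ->
  g \in <<killing_steps G x>>.
Proof.
move=> xG gG g3 xg3 zx zg; rewrite -groupV; apply/mem_gen/killing_stepsP.
split; first exact: groupVr.
exists (x ^ (g^-1 * g^-1)); first by rewrite memJ_class ?groupM ?groupV.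
exact: commute_order3 g3 xg3 zx zg.
Qed.

(** Conjugation by [h^-1] carries steps of [x ^ h] to steps of [x], so generation may be checked on
    any convenient conjugate. *)
Lemma gen_killing_stepsJ (G : {group gT}) (x h : gT) : h \in G ->
  G \subset <<killing_steps G (x ^ h)>> -> G \subset <<killing_steps G x>>.
Proof.
move=> hG genG; rewrite -(conjSg _ _ h) conjGid // -genJ; apply: subset_trans genG _.
apply: genS; apply/subsetP=> g /killing_stepsP[gG [y yx yg]].
rewrite mem_conjg; apply/killing_stepsP; split; first by rewrite groupJ ?groupV.
exists (y ^ h^-1).
  by rewrite class_sym classGidl ?groupV // class_sym -(classGidl x hG).
have -> : x * x ^ (g ^ h^-1) = (x ^ h * (x ^ h) ^ g) ^ h^-1.
  by rewrite conjMg -!conjgM mulgV conjg1 !mulgA (conjgE g) invgK !mulgA.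
by rewrite /commute -!conjMg yg.
Qed.

End GroupLemmas.

(** * Conjugation symmetry of the Killing graph and a criterion for connectedness *)

Section Adjacency.

Variables (gT : finGroupType) (G : {group gT}).
Local Open Scope group_scope.

Lemma killing_adjP (C : {set gT}) (a b : gT) : C \subset G ->
  reflect [/\ a \in C, b \in C, a != b & exists2 c, c \in C & commute c (a * b)]
          (killing_adj G C a b).
Proof.
move=> sCG; apply: (iffP and4P) => -[aC bC ab].
  by case/set0Pn=> c /setIP[/setIP[_ /cent1P cab] cC]; split=> //; exists c.
case=> c cC cab; split=> //; apply/set0Pn; exists c.
by rewrite !in_setI cC (subsetP sCG) //= andbT; apply/cent1P.
Qed.

Variable x : gT.
Hypothesis xG : x \in G.
Let C := x ^: G.

Let sCG : C \subset G. Proof. exact: class_subG. Qed.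

Let memCJ a g : g \in G -> (a ^ g \in C) = (a \in C).
Proof. by move=> gG; rewrite /C !(class_sym _ _ x) classGidl. Qed.

Lemma killing_adjJ a b g : g \in G ->
  killing_adj G C a b -> killing_adj G C (a ^ g) (b ^ g).
Proof.
move=> gG /killing_adjP-/(_ sCG)[aC bC ab [c cC cab]].
apply/killing_adjP=> //; split; rewrite ?memCJ ?(inj_eq (conjg_inj g)) //.
exists (c ^ g); rewrite ?memCJ //.
by rewrite /commute -conjMg -!conjMg cab.
Qed.

Lemma connect_killing_adjJ a b g : g \in G ->
  connect (killing_adj G C) a b -> connect (killing_adj G C) (a ^ g) (b ^ g).
Proof.
move=> gG /connectP[s]; elim: s a => [|c s IHs] a /=; first by move=> _ ->.
case/andP=> ac /IHs IH /IH; apply: connect_trans.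
exact/connect1/killing_adjJ.
Qed.

(** Since [v * u = (u * v) ^ u], conjugating a witness for [u * v] by [u] gives one for [v * u]. *)
Lemma connect_killing_adj_sym : connect_sym (killing_adj G C).
Proof.
apply: sym_connect_sym => a b.
suff H u v : killing_adj G C u v -> killing_adj G C v u by apply/idP/idP; apply: H.
case/killing_adjP=> // uC vC uv [c cC cuv]; apply/killing_adjP=> //.
have uG := subsetP sCG _ uC.
split=> //; first by rewrite eq_sym.
exists (c ^ u); first by rewrite memCJ.
have -> : v * u = (u * v) ^ u by rewrite conjgE mulgA mulKg.
by rewrite /commute -!conjMg cuv.
Qed.

Lemma killing_irreducible_gen :
  G \subset <<killing_steps G x>> ->
  killing_irreducible G C.
Proof.
move=> genG.
pose S := [set g in G | connect (killing_adj G C) x (x ^ g)].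
have gS : group_set S.
  apply/group_setP; split; first by rewrite inE group1 conjg1 connect0.
  move=> g h; rewrite !inE => /andP[gG xg] /andP[hG xh]; rewrite groupM //=.
  (* A path from [x] to [x ^ h] is followed by the [h]-conjugate of a path from [x] to [x ^ g]. *)
  apply: connect_trans xh _; rewrite conjgM; exact: connect_killing_adjJ.
have sGS : G \subset Group gS.
  apply: subset_trans genG _; rewrite gen_subG; apply/subsetP=> g.
  case/killing_stepsP=> gG [y yC yx]; rewrite inE gG /=.
  have [<-|xg] := eqVneq x (x ^ g); first exact: connect0.
  apply/connect1/killing_adjP=> //; split=> //; rewrite ?memCJ // ?class_refl //.
  by exists y.
have connx a : a \in C -> connect (killing_adj G C) x a.
  by case/imsetP=> g /(subsetP sGS); rewrite inE => /andP[_ ?] ->.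
move=> a b /connx xa /connx; apply: connect_trans.
by rewrite connect_killing_adj_sym.
Qed.

End Adjacency.

(** * Classes of involutions on which commuting is an equivalence relation *)

Section CommutingBlocks.

Variables (gT : finGroupType) (G : {group gT}) (x : gT).
Local Open Scope group_scope.
Hypothesis xG : x \in G.
Let C := x ^: G.
Hypothesis xx1 : x * x = 1.
Hypothesis commC : {in C & &, forall a b c, a != b ->
  commute c (a * b) -> commute a b /\ commute c a}.
Hypothesis transC : {in C & &, forall a b c,
  commute a b -> commute b c -> commute a c}.
Hypothesis ncommC : exists2 a, a \in C & ~ commute x a.

Let sCG : C \subset G. Proof. exact: class_subG. Qed.

(** Adjacent elements commute by [commC], and [transC] propagates this along paths, so connectedness
    would make [x] commute with all of [C]. *)
Lemma commuting_not_killing_irreducible : ~ killing_irreducible G C.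
Proof.
case: ncommC => a aC nxa irr; apply: nxa.
have xC : x \in C by apply: class_refl.
have /connectP[s] := irr x a xC aC; elim: s x xC => [|c s IHs] b bC /=.
  by move=> _ ->.
case/andP=> /killing_adjP-/(_ sCG)[_ cC bc [d dC dbc]] ps la.
have [cbc _] := commC bC cC dC bc dbc.
exact: transC bC cC aC cbc (IHs _ cC ps la).
Qed.

Let m := #|'C_G[x] :&: C|.

Let sqC a : a \in C -> a * a = 1.
Proof. by case/imsetP=> g _ ->; rewrite -conjMg xx1 conj1g. Qed.

Let centC a : a \in C -> #|'C_G[a] :&: C| = m.
Proof.
case/imsetP=> g gG ->.
by rewrite /m -[RHS](cardJg _ g) !conjIg conjGid // -cent1J -class_rcoset rcoset_id.
Qed.

Lemma killing_diag a : a \in C -> #|'C_G[a * a] :&: C| = #|C|.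
Proof. by move=> aC; rewrite sqC // cent11T setIT (setIidPr sCG). Qed.

(** If [a] and [b] commute, transitivity makes centralising [a * b] the same as centralising [a]
    within [C]; otherwise [commC] leaves no candidate. *)
Lemma killing_offdiag a b : a \in C -> b \in C -> a != b ->
  #|'C_G[a * b] :&: C| = if b \in 'C[a] then m else 0.
Proof.
move=> aC bC ab; case: ifP => [/cent1P ba|nba].
  rewrite -(centC aC); apply: eq_card => c; rewrite !in_setI.
  have [cC|] := boolP (c \in C); rewrite ?andbF // (subsetP sCG) //= !andbT.
  apply/cent1P/cent1P => [cab|ca]; first by have [] := commC aC bC cC ab cab.
  by apply: commuteM => //; apply: transC ca _.
apply/eqP; rewrite cards_eq0; apply/eqP/setP=> c; rewrite !in_setI in_set0.
apply/negP=> /andP[/andP[_ /cent1P cab] cC]; case/negP: nba; apply/cent1P.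
by have [/commute_sym] := commC aC bC cC ab cab.
Qed.

Lemma commuting_killing_nondegenerate : killing_nondegenerate G C.
Proof.
have xC : x \in C by apply: class_refl.
have ltmC : m < #|C|.
  rewrite proper_card // properE subsetIr; case: ncommC => a aC nxa.
  apply/subsetPn; exists a; rewrite // !in_setI aC andbT (subsetP sCG) //=.
  by apply/negP=> /cent1P/commute_sym.
pose com (i j : 'I_#|C|) := enum_val j \in 'C[enum_val i].
have comP i j : reflect (commute (enum_val i) (enum_val j)) (com i j).
  by rewrite /com; apply: (iffP cent1P) => /commute_sym.
have comC i j : com i j = com j i by apply/comP/comP; rewrite /commute => ->.
have com_eq i j : com i j -> com i =1 com j.
  move=> ij k; have Cv (l : 'I_#|C|) : enum_val l \in C by apply: enum_valP.
  have ij1 := comP _ _ ij; have ji1 := commute_sym ij1.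
  by apply/comP/comP; apply: transC => //; apply: Cv.
have Kij i j : killing_mx G C i j
    = ((i == j)%:R * (#|C| - m)%:R + (com i j)%:R * m%:R)%R.
  rewrite mxE; have [->|ij] := eqVneq i j.
    by rewrite killing_diag ?enum_valP // (introT (comP _ _)) // !mul1r -natrD subnK 1?ltnW.
  rewrite killing_offdiag ?enum_valP ?(inj_eq enum_val_inj) // -/(com i j).
  by case: (com i j); rewrite mul0r add0r ?mul1r ?mul0r.
rewrite /killing_nondegenerate -row_free_unit; apply: inj_row_free => v vK.
pose T j := (\sum_(i | com j i) v 0 i)%R.
have vT j : ((#|C| - m)%:R * v 0 j + m%:R * T j = 0)%R.
  have /rowP/(_ j) := vK; rewrite !mxE => <-.
  under eq_bigr do rewrite Kij mulrDr; rewrite big_split /=; congr (_ + _)%R.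
    rewrite (bigD1 j) //= eqxx mul1r mulrC big1 ?addr0 // => i /negPf->.
    by rewrite mul0r mulr0.
  rewrite /T big_mkcond mulr_sumr; apply: eq_bigr => i _; rewrite comC.
  by case: (com i j); rewrite ?mul1r ?mul0r ?mulr0 // mulrC.
have card_com j : #|com j| = m.
  rewrite -(centC (enum_valP j)) -(card_imset _ enum_val_inj).
  apply: eq_card => c; rewrite !in_setI; apply/imsetP/idP=> [[i ij ->]|].
    by rewrite enum_valP (subsetP sCG) ?enum_valP //= andbT.
  case/andP=> /andP[_ cj] cC; exists (enum_rank_in cC c); last by rewrite enum_rankK_in.
  by rewrite unfold_in /com enum_rankK_in.
(* Summing the equations [vT] over the block of [j] gives [(#|C| - m + m * m) * T j = 0], with a
   positive coefficient because [m < #|C|]. *)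
have T0 j : T j = 0%R.
  have : (\sum_(i | com j i) ((#|C| - m)%:R * v 0 i + m%:R * T i) = 0)%R.
    by rewrite big1.
  rewrite big_split -!mulr_sumr -/(T j) /= (eq_bigr (fun=> T j)); last first.
    by move=> i ji; apply: eq_bigl => k; rewrite (com_eq _ _ ji).
  rewrite sumr_const card_com -[(T j *+ m)%R]mulr_natl mulrA -mulrDl -natrM -natrD => /eqP.
  by rewrite mulf_eq0 Num.Theory.pnatr_eq0 addn_eq0 subn_eq0 leqNgt ltmC => /eqP.
apply/rowP=> j; rewrite mxE; have /eqP := vT j; rewrite T0 mulr0 addr0 mulf_eq0.
by rewrite Num.Theory.pnatr_eq0 subn_eq0 leqNgt ltmC => /eqP.
Qed.

End CommutingBlocks.

(** * Transfer of the claim along a homomorphism with central kernel *)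

Section CentralImage.

Variables (aT rT : finGroupType) (p : nat) (G : {group aT}) (f : {morphism G >-> rT}).
Local Open Scope group_scope.

Hypothesis ker_central : {in G, forall z, f z = 1 -> z \in 'Z(G)}.
Hypothesis gen_p : {in G, forall x, p.-elt x -> x * x != 1 ->
  G \subset <<killing_steps G x>>}.
Hypothesis inv_comm : p = 2 -> {in G & &, forall a b c,
  a * a = 1 -> b * b = 1 -> c * c = 1 -> p.-elt c -> c != 1 -> a != b ->
  commute c (a * b) -> commute a b /\ commute c a}.
Hypothesis inv_trans : p = 2 -> {in G & &, forall a b c,
  a * a = 1 -> b * b = 1 -> c * c = 1 -> p.-elt b -> b != 1 ->
  commute a b -> commute b c -> commute a c}.
Hypothesis p_ncomm : {in G, forall x, p.-elt x -> x != 1 ->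
  exists2 g, g \in G & ~ commute x (x ^ g)}.

(** A central element commutes with all its conjugates, which [p_ncomm] forbids for a non-trivial
    [p]-element. *)
Let central_p'elt z : z \in 'Z(G) -> p.-elt z -> z = 1.
Proof.
case/setIP=> zG /centP cz pz; apply/eqP/negPn/negP=> /(p_ncomm zG pz)[g gG].
by case; apply: cz; rewrite groupJ.
Qed.

Let ker_p_elt z : z \in G -> p.-elt z -> f z = 1 -> z = 1.
Proof. by move=> zG pz fz; apply: central_p'elt pz; apply: ker_central. Qed.

(** The element [a * b^-1] lies in the kernel and is central, so [a] and [b] commute; then
    [a * b^-1] is a central [p]-element. *)
Let p_elt_inj a b : a \in G -> b \in G -> p.-elt a -> p.-elt b -> f a = f b -> a = b.
Proof.
move=> aG bG pa pb fab.
have fz : f (a * b^-1) = 1 by rewrite morphM ?groupV // morphV // fab mulgV.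
have zZ := ker_central (groupM aG (groupVr bG)) fz.
have cab : commute a b^-1.
  have /setIP[_ /centP/(_ b bG) czb] := zZ.
  have cab : commute a b by rewrite -[a](mulgKV b); apply: commute_sym; apply: commuteM => //; apply: commute_sym.
  exact: commuteV.
apply/eqP; rewrite eq_mulgV1; apply/eqP/central_p'elt => //.
by apply: p_eltM; rewrite ?p_eltV.
Qed.

(* The p-elements c^y and c differ by a central element, hence by the identity. *)
Let commute_lift c y : c \in G -> y \in G -> p.-elt c ->
  commute (f c) (f y) -> commute c y.
Proof.
move=> cG yG pc /commgP; rewrite -morphR // => /eqP fcy.
have := p_elt_inj (groupJ cG yG) cG _ pc; rewrite p_eltJ pc morphJ // => ccy.
apply/commgP/conjg_fixP/ccy => //.
by apply/conjg_fixP; rewrite -morphR // fcy.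
Qed.

Lemma unipotent_class_claim_morphim (C : {set rT}) :
  unipotent_class_claim p (f @* G) C.
Proof.
case/imsetP=> y /morphimP[z _ zG ->] -> pC.
(* The [p]-part of the preimage [z] is still a preimage, because [f z] is a [p]-element. *)
set x := z.`_p; have xG : x \in G by rewrite groupX.
have [pfz fz1] := pC _ (class_refl _ _).
have px : p.-elt x by apply: p_elt_constt.
have fx : f z = f x by rewrite morph_constt // constt_p_elt.
move: pC fz1; rewrite fx => pC fx1.
have x1 : x != 1 by apply: contraNneq fx1 => ->; rewrite morph1.
have fxG : f x \in f @* G by apply: mem_morphim.
have liftC c : c \in f x ^: (f @* G) -> exists c', [/\ c' \in x ^: G, c' \in G, p.-elt c' & c = f c'].
  case/imsetP=> _ /morphimP[g _ gG ->] ->; exists (x ^ g).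
  by rewrite memJ_class // groupJ // p_eltJ px morphJ.
(* As [x * x] is a [p]-element, it is trivial as soon as its image is. *)
have sqC : (forall c, c \in f x ^: (f @* G) -> #[c] = 2) <-> x * x = 1.
  split=> [/(_ _ (class_refl _ _)) ofx | xx1 _ /imsetP[g _ ->]].
    have := expg_order (f x); rewrite ofx -morphX // expgS expg1.
    by apply: ker_p_elt; rewrite ?groupM //; apply: p_eltM.
  rewrite orderJ; apply: nt_prime_order => //.
  by rewrite -morphX // expgS expg1 xx1 morph1.
have inv_reducible : x * x = 1 ->
    ~ killing_irreducible (f @* G) (f x ^: (f @* G))
    /\ killing_nondegenerate (f @* G) (f x ^: (f @* G)).
  move=> xx1; have p2 : p = 2.
    have ox : #[x] = 2 by apply: nt_prime_order.
    by move: px; rewrite /p_elt ox pnatE // inE => /eqP.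
  have sqG c : c \in x ^: G -> c * c = 1 /\ c != 1.
    by case/imsetP=> g _ ->; rewrite -conjMg xx1 conj1g conjg_eq1.
  have fxx1 : f x * f x = 1 by rewrite -morphM // xx1 morph1.
  have commC : {in f x ^: (f @* G) & &, forall a b c, a != b ->
      commute c (a * b) -> commute a b /\ commute c a}.
    move=> _ _ _ /liftC[a [aC aG pa ->]] /liftC[b [bC bG pb ->]] /liftC[c [cC cG pc ->]].
    move=> ab; rewrite -morphM // => /commute_lift cab.
    have [[aa1 _] [bb1 _] [cc1 c1]] := And3 (sqG a aC) (sqG b bC) (sqG c cC).
    have nab : a != b by apply: contraNneq ab => ->.
    have [|cmab cmca] := inv_comm p2 aG bG cG aa1 bb1 cc1 pc c1 nab.
      by apply: cab; rewrite ?groupM.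
    by rewrite /commute -!morphM // cmab cmca.
  have transC : {in f x ^: (f @* G) & &, forall a b c,
      commute a b -> commute b c -> commute a c}.
    move=> _ _ _ /liftC[a [aC aG pa ->]] /liftC[b [bC bG pb ->]] /liftC[c [cC cG pc ->]].
    move=> /commute_lift ab /commute_lift bc.
    have [[aa1 _] [bb1 b1] [cc1 _]] := And3 (sqG a aC) (sqG b bC) (sqG c cC).
    have ac := inv_trans p2 aG bG cG aa1 bb1 cc1 pb b1 (ab aG bG pa) (bc bG cG pb).
    by rewrite /commute -!morphM // ac.
  have ncommC : exists2 a, a \in f x ^: (f @* G) & ~ commute (f x) a.
    have [g gG ncx] := p_ncomm xG px x1.
    exists (f x ^ f g); first by rewrite memJ_class // mem_morphim.
    rewrite -morphJ // => /commute_lift xxg; apply: ncx.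
    by apply: xxg; rewrite ?groupJ.
  split; first exact: (commuting_not_killing_irreducible fxG commC transC ncommC).
  exact: (commuting_killing_nondegenerate fxG fxx1 commC transC ncommC).
split; last by move/sqC/inv_reducible => [].
split=> [irr /sqC/inv_reducible[] // | /sqC nsq].
(* Steps of [x] map to steps of [f x], so generation passes to the image. *)
apply: killing_irreducible_gen => //.
apply: (@subset_trans _ _ (mem (f @* <<killing_steps G x>>))).
  by apply/morphimS/gen_p => //; apply/eqP.
rewrite morphim_gen ?genS //; last by apply/subsetP=> g /killing_stepsP[].
apply/subsetP=> _ /morphimP[g gG /killing_stepsP[_ [c /imsetP[h hG ->] com]] ->].
apply/killing_stepsP; split; first exact: mem_morphim.
exists (f x ^ f h); first by rewrite memJ_class ?mem_morphim.
have [xhG xgG] := (groupJ xG hG, groupJ xG gG).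
by rewrite -!morphJ // -(morphM f xG xgG) /commute -!morphM ?(groupM xG xgG) // com.
Qed.

End CentralImage.

(** * Matrices with named entries, turning matrix identities into ring identities *)

Section Matrices3.

Variable F : finFieldType.
Local Open Scope ring_scope.

Definition mx3 (a b c d e f g h i : F) : 'M[F]_3 :=
  \matrix_(r, k) nth 0 (nth [::] [:: [:: a; b; c]; [:: d; e; f]; [:: g; h; i]] r) k.

Definition cv3 (x y z : F) : 'cV[F]_3 := \col_r nth 0 [:: x; y; z] r.

Lemma mx3P (A : 'M[F]_3) : exists a b c d e f g h i, A = mx3 a b c d e f g h i.
Proof.
pose A_ i j := A (inord i) (inord j).
exists (A_ 0 0)%N, (A_ 0 1)%N, (A_ 0 2)%N, (A_ 1 0)%N, (A_ 1 1)%N, (A_ 1 2)%N, (A_ 2 0)%N,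
  (A_ 2 1)%N, (A_ 2 2)%N.
apply/matrixP=> i j; rewrite mxE -[i in LHS]inord_val -[j in LHS]inord_val.
by case: i j => [[|[|[|//]]] ?] [[|[|[|//]]] ?].
Qed.

Lemma cv3P (v : 'cV[F]_3) : exists x y z, v = cv3 x y z.
Proof.
exists (v (inord 0) 0), (v (inord 1) 0), (v (inord 2) 0).
apply/matrixP=> i j; rewrite mxE (ord1 j) -[i in LHS]inord_val.
by case: i => [[|[|[|//]]] ?].
Qed.

Lemma mx3_inj a b c d e f g h i a' b' c' d' e' f' g' h' i' :
  mx3 a b c d e f g h i = mx3 a' b' c' d' e' f' g' h' i' ->
  [/\ [/\ a = a', b = b' & c = c'], [/\ d = d', e = e' & f = f']
    & [/\ g = g', h = h' & i = i']].
Proof.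
move/matrixP=> eqA.
have E r k := eqA (inord r) (inord k).
move: (E 0 0) (E 0 1) (E 0 2) (E 1 0) (E 1 1) (E 1 2) (E 2 0) (E 2 1) (E 2 2)%N.
by rewrite !mxE !inordK.
Qed.

Lemma cv3_inj x y z x' y' z' : cv3 x y z = cv3 x' y' z' -> [/\ x = x', y = y' & z = z'].
Proof.
move/matrixP=> eqA; have E r := eqA (inord r) 0; move: (E 0) (E 1) (E 2)%N.
by rewrite !mxE !inordK.
Qed.

Lemma mul_mx3 a b c d e f g h i a' b' c' d' e' f' g' h' i' :
  mx3 a b c d e f g h i *m mx3 a' b' c' d' e' f' g' h' i' =
  mx3 (a * a' + b * d' + c * g') (a * b' + b * e' + c * h') (a * c' + b * f' + c * i')
      (d * a' + e * d' + f * g') (d * b' + e * e' + f * h') (d * c' + e * f' + f * i')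
      (g * a' + h * d' + i * g') (g * b' + h * e' + i * h') (g * c' + h * f' + i * i').
Proof.
apply/matrixP=> r k; rewrite !mxE !big_ord_recl big_ord0 !mxE addr0 !addrA.
by case: r k => [[|[|[|//]]] ?] [[|[|[|//]]] ?].
Qed.

Lemma mul_mx3_cv3 a b c d e f g h i x y z :
  mx3 a b c d e f g h i *m cv3 x y z =
  cv3 (a * x + b * y + c * z) (d * x + e * y + f * z) (g * x + h * y + i * z).
Proof.
apply/matrixP=> r k; rewrite !mxE !big_ord_recl big_ord0 !mxE addr0 !addrA.
by case: r => [[|[|[|//]]] ?].
Qed.

Lemma mx3_1 : 1%:M = mx3 1 0 0 0 1 0 0 0 1.
Proof.
by apply/matrixP=> r k; rewrite !mxE; case: r k => [[|[|[|//]]] ?] [[|[|[|//]]] ?].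
Qed.

Lemma det_mx3 a b c d e f g h i :
  \det (mx3 a b c d e f g h i)
    = a * (e * i - f * h) - b * (d * i - f * g) + c * (d * h - e * g).
Proof.
rewrite (expand_det_row _ ord0) !big_ord_recl big_ord0 !mxE /= /cofactor.
rewrite !(expand_det_row _ ord0) !big_ord_recl !big_ord0 /cofactor !det_mx11 !mxE /=.
by ring.
Qed.

End Matrices3.

Lemma GLval_inj (F : finFieldType) : injective (@GLval 3 F).
Proof. exact: val_inj. Qed.

(** * The special unitary group of the antidiagonal Hermitian form *)

Section UnitaryGroup.

Variables (F : finFieldType) (s : {rmorphism F -> F}).
Local Open Scope ring_scope.
Hypothesis sK : involutive s.

Definition antidiag3 : 'M[F]_3 := mx3 0 0 1 0 1 0 1 0 0.

(** The adjoint for the form with Gram matrix [antidiag3], which is its own inverse. *)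
Definition hadj (A : 'M[F]_3) : 'M[F]_3 := antidiag3 *m (map_mx s A)^T *m antidiag3.

Lemma hadj_mx3 a b c d e f g h i : hadj (mx3 a b c d e f g h i) =
  mx3 (s i) (s f) (s c) (s h) (s e) (s b) (s g) (s d) (s a).
Proof.
have -> : hadj (mx3 a b c d e f g h i) =
    antidiag3 *m mx3 (s a) (s d) (s g) (s b) (s e) (s h) (s c) (s f) (s i) *m antidiag3.
  congr (_ *m _ *m _); apply/matrixP=> r k; rewrite !mxE.
  by case: r k => [[|[|[|//]]] ?] [[|[|[|//]]] ?].
by rewrite !mul_mx3; congr mx3; ring.
Qed.

Lemma antidiag3K : antidiag3 *m antidiag3 = 1%:M.
Proof. by rewrite mul_mx3 mx3_1; congr mx3; ring. Qed.

Lemma hadjM A B : hadj (A *m B) = hadj B *m hadj A.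
Proof.
rewrite /hadj map_mxM trmx_mul -!mulmxA; congr (_ *m (_ *m _)).
by rewrite (mulmxA antidiag3) antidiag3K mul1mx.
Qed.

Lemma hadj1 : hadj 1%:M = 1%:M.
Proof. by rewrite [in LHS]mx3_1 hadj_mx3 rmorph0 rmorph1 mx3_1. Qed.

Definition SU_antidiag : {set {'GL_3[F]}} :=
  [set g : {'GL_3[F]} | (hadj (GLval g) *m GLval g == 1%:M) && (\det (GLval g) == 1)].

Lemma SU_antidiagP (g : {'GL_3[F]}) :
  reflect (hadj (GLval g) *m GLval g = 1%:M /\ \det (GLval g) = 1) (g \in SU_antidiag).
Proof. by rewrite inE; apply: (iffP andP) => -[/eqP ? /eqP ?]. Qed.

Lemma SU_antidiag_group_set : group_set SU_antidiag.
Proof.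
apply/group_setP; split=> [|g h /SU_antidiagP[g1 dg] /SU_antidiagP[h1 dh]]; apply/SU_antidiagP.
  by rewrite -[GLval 1%g]/(1%:M) det1 mulmx1 hadj1.
rewrite GL_MxE hadjM det_mulmx dg dh mulr1; split=> //.
by rewrite mulmxA -(mulmxA (hadj (GLval h))) g1 mulmx1.
Qed.
Definition SU_antidiag_group := Group SU_antidiag_group_set.
Local Notation G := SU_antidiag_group.

Lemma SU_antidiag_mx (A : 'M[F]_3) : hadj A *m A = 1%:M -> \det A = 1 ->
  exists2 g : {'GL_3[F]}, g \in G & GLval g = A.
Proof.
move=> A1 dA; have uA : A \is a GRing.unit by rewrite unitmxE in dA *; rewrite dA unitr1.
by exists (FinRing.unit _ uA : {'GL_3[F]}); first apply/SU_antidiagP.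
Qed.

Lemma GL_mul (g h : {'GL_3[F]}) : GLval (g * h)%g = GLval g *m GLval h.
Proof. by []. Qed.

Lemma SU_antidiagV g : g \in G -> GLval g^-1%g = hadj (GLval g).
Proof.
move=> /SU_antidiagP[g1 _]; rewrite -[RHS]mulmx1.
have <- : GLval g *m GLval g^-1%g = 1%:M by rewrite -GL_mul mulgV.
by rewrite mulmxA g1 mul1mx.
Qed.

(** Under [b + s b + a * s a = 0] these matrices form the stabiliser of [e1]; the non-trivial ones
    with [a = 0] are the transvections. *)
Definition utri (a b : F) : 'M[F]_3 := mx3 1 a b 0 1 (- s a) 0 0 1.
Definition e1 : 'cV[F]_3 := cv3 1 0 0.
Definition isotropic x y z := s x * z + s y * y + s z * x = 0.

Lemma mul_utri a b a' b' : utri a b *m utri a' b' = utri (a + a') (b' - a * s a' + b).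
Proof. by rewrite mul_mx3 /utri rmorphD; congr mx3; ring. Qed.

Lemma utri_SU a b : b + s b + a * s a = 0 -> exists2 u, u \in G & GLval u = utri a b.
Proof.
move=> ab0; apply: SU_antidiag_mx; last by rewrite det_mx3; ring.
have sb : s b = - (b + a * s a) by apply/eqP; rewrite -addr_eq0 addrCA addrA ab0.
rewrite hadj_mx3 mul_mx3 mx3_1 !(rmorph0, rmorph1, rmorphN, sK) sb.
by congr mx3; ring.
Qed.

Lemma SU_mx3P g : g \in G -> exists a b c d e f h i j,
  [/\ GLval g = mx3 a b c d e f h i j,
      hadj (GLval g) *m mx3 a b c d e f h i j = mx3 1 0 0 0 1 0 0 0 1
    & a * (e * j - f * i) - b * (d * j - f * h) + c * (d * i - e * h) = 1].
Proof.
case/SU_antidiagP; have [a [b [c [d [e [f [h [i [j ->]]]]]]]]] := mx3P (GLval g).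
by rewrite mx3_1 det_mx3 => g1 dg; exists a, b, c, d, e, f, h, i, j.
Qed.

Lemma mx3_e1 a b c d e f g h i : mx3 a b c d e f g h i *m e1 = cv3 a d g.
Proof. by rewrite mul_mx3_cv3; congr cv3; ring. Qed.

(** Pairing with the first column [e1] determines the last row, the determinant gives the middle
    entry, and the pairings of the other columns with the third give the remaining relations. *)
Lemma SU_fix_e1 g : g \in G -> GLval g *m e1 = e1 ->
  exists a b, GLval g = utri a b /\ b + s b + a * s a = 0.
Proof.
case/SU_mx3P=> a [b [c [d [e [f [h [i [j [-> ]]]]]]]]].
rewrite hadj_mx3 mul_mx3 mx3_e1 => /mx3_inj[[_ _ eq13] [_ _ eq23] [_ eq32 eq33]] dg.
move/cv3_inj=> [a1 d0 h0]; rewrite {}a1 {}d0 {}h0 !(rmorph0, rmorph1) in eq13 eq23 eq32 eq33 dg *.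
have i0 : i = 0 by rewrite -eq32; ring.
have j1 : j = 1 by rewrite -eq33; ring.
rewrite {}i0 {}j1 !(rmorph0, rmorph1) in eq13 eq23 dg *.
have e1' : e = 1 by rewrite -dg; ring.
rewrite {}e1' !(rmorph0, rmorph1) in eq13 eq23 dg *.
have fb : f = - s b by apply/eqP; rewrite -addr_eq0 -[X in _ == X]eq23; apply/eqP; ring.
exists b, c; rewrite /utri -fb; split=> //; rewrite -[RHS]eq13 fb rmorphN sK; ring.
Qed.

Lemma SU_isotropic g x y z : g \in G -> GLval g *m e1 = cv3 x y z -> isotropic x y z.
Proof.
case/SU_mx3P=> a [b [c [d [e [f [h [i [j [-> ]]]]]]]]].
rewrite hadj_mx3 mul_mx3 mx3_e1 => /mx3_inj[_ _ [eq31 _ _]] _ /cv3_inj[<- <- <-].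
by rewrite /isotropic -[RHS]eq31; ring.
Qed.

(** Geometrically, the isotropic vectors orthogonal to [e1] lie on the line of [e1]. *)
Lemma isotropic0 x y : isotropic x y 0 -> y = 0.
Proof.
rewrite /isotropic mulr0 rmorph0 mul0r add0r addr0 => /eqP.
by rewrite mulf_eq0 fmorph_eq0 orbb => /eqP.
Qed.

(** The matrix is forced: the second coordinate requires [s a = Y] and the first gives [b]. Isotropy
    of both vectors is what places [utri (s Y) b] in [G]. *)
Lemma SU_fix_e1_trans x y x' y' z : z != 0 -> isotropic x y z -> isotropic x' y' z ->
  exists2 u, u \in G & GLval u *m e1 = e1 /\ GLval u *m cv3 x y z = cv3 x' y' z.
Proof.
rewrite /isotropic => z0 iso iso'.
have sz0 : s z != 0 by rewrite fmorph_eq0.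
pose Y := (y - y') / z; pose b := (x' - x - s Y * y) / z.
have [|u uG defu] := @utri_SU (s Y) b.
  rewrite /b /Y sK !(rmorphB, rmorphM, fmorphV, sK).
  have -> : s x = - (s y * y + s z * x) / z.
    by apply: (canRL (mulfK z0)); apply/eqP; rewrite -addr_eq0 addrA iso.
  have -> : s x' = - (s y' * y' + s z * x') / z.
    by apply: (canRL (mulfK z0)); apply/eqP; rewrite -addr_eq0 addrA iso'.
  by field; rewrite z0 sz0.
exists u; rewrite // defu /utri mx3_e1 mul_mx3_cv3 sK /b /Y; split=> //.
by congr cv3; field; rewrite ?z0.
Qed.

(** A vector on the line of [e1] is reached by a diagonal matrix. Otherwise an antidiagonal matrix
    reaches [cv3 0 0 z], which the stabiliser of [e1] moves to the target. *)
Lemma SU_trans x y z : isotropic x y z -> cv3 x y z != 0 ->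
  exists2 g, g \in G & GLval g *m e1 = cv3 x y z.
Proof.
move=> iso v0; have [z0|z0] := eqVneq z 0.
  move: iso v0; rewrite z0 => /isotropic0-> v0.
  have x0 : x != 0.
    by apply: contraNneq v0 => ->; apply/eqP/matrixP=> r k; rewrite !mxE; case: r => [[|[|[|//]]] ?].
  have sx0 : s x != 0 by rewrite fmorph_eq0.
  have [||g gG defg] := @SU_antidiag_mx (mx3 x 0 0 0 (s x / x) 0 0 0 (s x)^-1).
  - rewrite hadj_mx3 mul_mx3 mx3_1 !(rmorph0, fmorph_div, fmorphV, sK).
    by congr mx3; field; rewrite ?x0 ?sx0.
  - by rewrite det_mx3; field; rewrite x0 sx0.
  by exists g; rewrite // defg mx3_e1.
have sz0 : s z != 0 by rewrite fmorph_eq0.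
have [||g gG defg] := @SU_antidiag_mx (mx3 0 0 (s z)^-1 0 (- (s z / z)) 0 z 0 0).
- rewrite hadj_mx3 mul_mx3 mx3_1 !(rmorph0, rmorphN, fmorph_div, fmorphV, sK).
  by congr mx3; field; rewrite ?z0 ?sz0.
- by rewrite det_mx3; field; rewrite z0 sz0.
have [||u uG [_ defu]] := @SU_fix_e1_trans 0 0 x y z z0 => //.
  by rewrite /isotropic !rmorph0; ring.
exists (u * g)%g; first exact: groupM.
by rewrite GL_mul -mulmxA defg mx3_e1 defu.
Qed.

Hypothesis norm_surj : forall x, s x = x -> exists y, y * s y = x.

(* The subgroup is transitive on isotropic points, so it suffices to reach every isotropic vector
   with a given last entry; conjugating the stabiliser of e1 by an element taking e1 to a
   multiple of e3 produces all such last entries. *)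
Lemma SU_antidiag_gen (S : {group {'GL_3[F]}}) g x y z :
  {in G, forall u : {'GL_3[F]}, GLval u *m e1 = e1 -> u \in S} ->
  g \in G -> g \in S -> GLval g *m e1 = cv3 x y z -> z != 0 -> G \subset S.
Proof.
move=> fixS gG gS defg z0.
have sz0 : s z != 0 by rewrite fmorph_eq0.
have iso0 : isotropic 0 0 z by rewrite /isotropic !rmorph0; ring.
have [u0 u0G [fixu0 defu0]] := SU_fix_e1_trans z0 (SU_isotropic gG defg) iso0.
pose t := (u0 * g)%g.
have tG : t \in G by apply: groupM.
have tS : t \in S by apply: groupM => //; apply: fixS.
have deft : GLval t *m e1 = cv3 0 0 z by rewrite GL_mul -mulmxA defg defu0.
clearbody t.
have get_l w : w != 0 -> exists l, [/\ l \in G, l \in S &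
    exists x' y', GLval l *m e1 = cv3 x' y' w].
  (* The last entry of [t^-1 * u * t] applied to [e1] is [s z * b * z]; this [b] makes it [w], and
     [norm_surj] supplies the matching [a]. *)
  move=> w0; pose b := w / (s z * z).
  have [|a aa] := norm_surj (x := - (b + s b)).
    by rewrite rmorphN rmorphD sK addrC.
  have [|u uG defu] := @utri_SU a b; first by rewrite aa subrr.
  have uS : u \in S by apply: fixS; rewrite // defu mx3_e1.
  exists (t^-1 * u * t)%g; split; rewrite ?groupM ?groupV //.
  rewrite !GL_mul -!mulmxA deft defu SU_antidiagV //.
  move: deft; have [a' [b' [c' [d' [e' [f' [h' [i' [j' ->]]]]]]]]] := mx3P (GLval t).
  rewrite mx3_e1 => /cv3_inj[-> -> ->].
  rewrite hadj_mx3 !mul_mx3_cv3 !rmorph0; do 2 eexists.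
  by congr cv3; rewrite /b; field; rewrite z0 sz0.
have big_cell h x' y' w : h \in G -> GLval h *m e1 = cv3 x' y' w -> w != 0 -> h \in S.
  move=> hG defh w0; have [l [lG lS [x2 [y2 defl]]]] := get_l w w0.
  have [u uG [fixu defu]] :=
    SU_fix_e1_trans w0 (SU_isotropic hG defh) (SU_isotropic lG defl).
  rewrite -(groupMl h (fixS u uG fixu)) -(groupMl _ (groupVr lS)) fixS ?groupM ?groupV //.
  rewrite !GL_mul -!mulmxA defh defu -defl mulmxA -GL_mul mulVg.
  exact: mul1mx.
apply/subsetP=> h hG; have [x' [y' [w defh]]] := cv3P (GLval h *m e1).
have [w0|w0] := eqVneq w 0; last exact: big_cell defh w0.
move: defh (SU_isotropic hG defh); rewrite w0 => defh /isotropic0 y0.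
rewrite {}y0 in defh.
have x0 : x' != 0.
  apply/eqP=> x0; have := congr1 (mulmx (GLval h^-1%g)) defh.
  rewrite mulmxA -GL_mul mulVg x0 [_ *m e1]mul1mx.
  have -> : cv3 0 0 0 = 0 :> 'cV[F]_3.
    by apply/matrixP=> r k; rewrite !mxE; case: r => [[|[|[|//]]] ?].
  rewrite mulmx0 => /matrixP/(_ 0 0); rewrite !mxE /= => /eqP.
  by rewrite oner_eq0.
(* Here [h] fixes the point of [e1], so [g * h] sends [e1] to a vector with non-zero last entry and
   [big_cell] applies to it. *)
rewrite -(groupMl h gS).
move: defg; have [a' [b' [c' [d' [e' [f' [h' [i' [j' defg]]]]]]]]] := mx3P (GLval g).
rewrite defg mx3_e1 => /cv3_inj[_ _ h'z].
apply: (big_cell _ (a' * x') (d' * x') (h' * x')); rewrite ?groupM //.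
  by rewrite GL_mul -mulmxA defh defg mul_mx3_cv3; congr cv3; ring.
by rewrite mulf_neq0 // h'z.
Qed.

(** * The Hermitian form and isotropic vectors fixed by unipotent elements *)

Definition hform (v w : 'cV[F]_3) : F := ((map_mx s v)^T *m antidiag3 *m w) 0 0.

Lemma hform_cv3 x y z x' y' z' :
  hform (cv3 x y z) (cv3 x' y' z') = s x * z' + s y * y' + s z * x'.
Proof.
rewrite /hform !mxE !big_ord_recl big_ord0 !mxE !big_ord_recl !big_ord0 !mxE /=.
ring.
Qed.

Lemma hform_SU g v w : g \in G -> hform (GLval g *m v) (GLval g *m w) = hform v w.
Proof.
case/SU_antidiagP=> g1 _; rewrite /hform map_mxM trmx_mul.
have {g1} g1 : (map_mx s (GLval g))^T *m antidiag3 *m GLval g = antidiag3.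
  rewrite -[RHS]mulmx1 -g1 /hadj !mulmxA antidiag3K mul1mx.
  by rewrite -!mulmxA.
rewrite -!mulmxA; congr ((_ *m _) 0 0).
by rewrite !mulmxA g1.
Qed.

Lemma hformBr u v w : hform u (v - w) = hform u v - hform u w.
Proof. by rewrite /hform mulmxBr !mxE. Qed.

(* The last nonzero power of x - 1 has isotropic image. *)
Lemma unipotent_fix_isotropic g n : g \in G -> g != 1%g ->
  (GLval g - 1) ^+ n = 0 ->
  exists x y z, [/\ isotropic x y z, cv3 x y z != 0 & GLval g *m cv3 x y z = cv3 x y z].
Proof.
move=> gG g1 Nn.
have exn : exists n, (GLval g - 1) ^+ n == 0 by exists n; apply/eqP.
case: (ex_minnP exn) => {Nn exn} {}n; case: n => [|[|n]].
- by rewrite expr0 oner_eq0.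
- by rewrite expr1 subr_eq0 => /eqP gE; case/eqP: g1; apply: GLval_inj.
set N := GLval g - 1 => /eqP Nn minN.
have N1 : N ^+ n.+1 != 0 by apply/eqP=> /eqP/minN; rewrite ltnn.
have [j Nj] : exists j, N ^+ n.+1 *m delta_mx j 0 != 0 :> 'cV[F]_3.
  apply/existsP; apply: contraR N1; rewrite negb_exists => /forallP N0.
  apply/eqP/matrixP=> i j; have /negPn/eqP/colP/(_ i) := N0 j.
  by rewrite -colE !mxE.
pose u : 'cV[F]_3 := N ^+ n *m delta_mx j 0.
have defN w : GLval g *m w - w = N *m w by rewrite mulmxBl mul1mx.
have defv : N ^+ n.+1 *m delta_mx j 0 = GLval g *m u - u.
  by rewrite defN /u mulmxA exprS.
move: Nj; rewrite defv; have [x [y [z defxyz]]] := cv3P (GLval g *m u - u).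
rewrite defxyz => v0.
have fixv : GLval g *m cv3 x y z = cv3 x y z.
  apply/eqP; rewrite -subr_eq0 defN -defxyz -defv mulmxA.
  by rewrite -[N *m N ^+ n.+1]/(N * N ^+ n.+1) -exprS Nn mul0mx.
(* The vector [v = g u - u] is fixed by [g], so [(v, v) = (g v, g u) - (v, u) = 0]. *)
exists x, y, z; split=> //; rewrite /isotropic -hform_cv3 -{2}defxyz hformBr.
by rewrite -{1}fixv hform_SU // subrr.
Qed.

(** * Elements of order a power of the characteristic *)

Variable p : nat.
Hypothesis charF : p \in [pchar F].

(** In characteristic [p], [(g - 1) ^ (p ^ m) = g ^ (p ^ m) - 1 = 0]. The resulting fixed isotropic
    vector is carried to [e1] by transitivity. *)
Lemma p_elt_fix_e1 g : g \in G -> (p.-elt g)%g -> g != 1%g ->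
  exists2 h, h \in G & GLval (g ^ h)%g *m e1 = e1.
Proof.
move=> gG pg g1; have [m og] := p_natP pg.
have charM : p \in [pchar 'M[F]_3].
  rewrite inE (pcharf_prime charF) /= -scaler_nat (pcharf0 charF) scale0r.
  exact: eqxx.
have Ng : (GLval g - 1) ^+ (p ^ m) = 0.
  have -> : (GLval g - 1) ^+ (p ^ m) = GLval g ^+ (p ^ m) - 1.
    elim: m {og} => [|m IHm]; first by rewrite !expr1.
    rewrite expnSr !exprM IHm -!(pFrobenius_autE charM).
    by rewrite pFrobenius_autB_comm ?pFrobenius_aut1 //; apply: commr1.
  apply/eqP; rewrite subr_eq0; apply/eqP.
  have <- : GLval (g ^+ (p ^ m))%g = 1 by rewrite -og expg_order.
  by elim: (p ^ m)%N => [//|k IHk]; rewrite exprS expgS IHk.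
have [x [y [z [iso v0 fixv]]]] := unipotent_fix_isotropic gG g1 Ng.
have [h hG defh] := SU_trans iso v0; exists h => //.
rewrite conjgE !GL_mul -!mulmxA defh fixv -defh mulmxA -GL_mul mulVg.
exact: mul1mx.
Qed.

(** Every [h] fixing [e1] is a step: [x] and [x ^ h] are unitriangular with the same entry [a],
    hence commute. One generated element [g] with [g e1] not orthogonal to [e1] then suffices. *)
Lemma SU_gen_killing_steps x a b g u v w : x \in G -> GLval x = utri a b ->
  g \in G -> g \in <<killing_steps G x>>%g -> GLval g *m e1 = cv3 u v w -> w != 0 ->
  G \subset <<killing_steps G x>>%g.
Proof.
move=> xG defx gG gS defg w0; apply: (SU_antidiag_gen _ gG gS defg w0) => h hG fixh.
apply/mem_gen/killing_stepsP; split=> //; exists x; first exact: class_refl.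
have fixx : GLval x *m e1 = e1 by rewrite defx mx3_e1.
have fixxh : GLval (x ^ h)%g *m e1 = e1.
  rewrite conjgE !GL_mul -!mulmxA fixh fixx -[in LHS]fixh mulmxA -GL_mul mulVg.
  exact: mul1mx.
have [a1 [b1 [defxh _]]] := SU_fix_e1 (groupJ xG hG) fixxh.
have [a2 [b2 [defh _]]] := SU_fix_e1 hG fixh.
have a1a : a1 = a.
  have : GLval (h * x ^ h)%g = GLval (x * h)%g by rewrite conjgE mulKVg.
  rewrite (GL_mul h) (GL_mul x) defx defxh defh !mul_utri addrC => /mx3_inj[[_ + _] _ _].
  exact: addIr.
have xxh : commute x (x ^ h)%g.
  by apply: GLval_inj; rewrite !(GL_mul x, GL_mul _ x) defx defxh a1a !mul_utri; congr utri; ring.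
by apply: commuteM.
Qed.

(* Here tr(g^-1) is the conjugate of tr g, so X^3 - 1 is the characteristic polynomial of g. *)
Lemma SU_trace0_order3 g a b c d e f h i j : g \in G ->
  GLval g = mx3 a b c d e f h i j -> a + e + j = 0 -> (g ^+ 3 = 1)%g.
Proof.
move=> gG defg tr0; have [g1 dg] := SU_antidiagP _ gG.
(* This is the adjugate of [g]; as the determinant is 1, it is the inverse, which is also
   [hadj (GLval g)]. *)
pose cof := mx3 (e * j - f * i) (c * i - b * j) (b * f - c * e)
                (f * h - d * j) (a * j - c * h) (c * d - a * f)
                (d * i - e * h) (b * h - a * i) (a * e - b * d).
have defcof : hadj (GLval g) = cof.
  rewrite -[RHS]mul1mx -g1 -mulmxA.
  suff -> : GLval g *m cof = 1%:M by rewrite mulmx1.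
  by move: dg; rewrite defg det_mx3 mul_mx3 mx3_1 => <-; congr mx3; ring.
have j0 : j = - (a + e) by apply/eqP; rewrite -addr_eq0 addrC tr0.
have e2 : a * e - b * d = - (e * j - f * i) - (a * j - c * h).
  move: defcof; rewrite defg hadj_mx3 => /mx3_inj[[s1 _ _] [_ s2 _] [_ _ <-]].
  rewrite -s1 -s2; have := congr1 s tr0; rewrite !rmorphD rmorph0 => s0.
  by apply/eqP; rewrite -subr_eq0 -s0; apply/eqP; ring.
(* Cayley-Hamilton: the adjugate is the square when the trace and the sum of the principal 2 by 2
   minors vanish. *)
have g2 : GLval g *m GLval g = hadj (GLval g).
  have fi : f * i = a * e - b * d - (a + e) * (a + e) - c * h by rewrite e2 j0; ring.
  by rewrite defcof defg mul_mx3 /cof j0; congr mx3; ring: fi.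
rewrite !expgS expg0 mulg1; apply: GLval_inj; rewrite !GL_mul g2.
by rewrite -SU_antidiagV // -GL_mul mulgV.
Qed.

(** * Generation by steps of regular unipotent elements and of transvections *)

Hypothesis cube_trace : exists2 t, t != 0 & t ^+ 3 + s t ^+ 3 != 0.

Lemma regular_gen_killing_steps x a b : x \in G -> GLval x = utri a b ->
  b + s b + a * s a = 0 -> a != 0 -> G \subset <<killing_steps G x>>%g.
Proof.
move=> xG defx ab0 a0; have sa0 : s a != 0 by rewrite fmorph_eq0.
have b0 : b != 0.
  by apply: contraNneq (mulf_neq0 a0 sa0) => b0; rewrite -ab0 b0 rmorph0 !add0r.
(* With the matrix [A] below, the trace of [x * g] is [t * (b - s a * m)], which this [m]
   cancels. *)
have [m defm] : exists m, m = b / s a by exists (b / s a).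
have m0 : m * s m != 0 by rewrite mulf_neq0 ?fmorph_eq0 // defm mulf_neq0 ?invr_neq0.
(* This equation is the isotropy of the last column of [A]. Scaling [t] by some [k] with [s k = k]
   divides the outer terms by [k], so [k] can be solved for; [cube_trace] makes it non-zero. *)
have [t t0 tm] : exists2 t, t != 0 & t / s t ^+ 2 + m * s m + s t / t ^+ 2 = 0.
  case: cube_trace => t t0 tr0; have st0 : s t != 0 by rewrite fmorph_eq0.
  pose k := - ((t ^+ 3 + s t ^+ 3) / (t ^+ 2 * s t ^+ 2)) / (m * s m).
  have k0 : k != 0.
    by rewrite mulf_neq0 ?invr_neq0 // oppr_eq0 mulf_neq0 // invr_neq0 // mulf_neq0 ?expf_neq0.
  have sk : s k = k.
    rewrite /k fmorph_div rmorphN fmorph_div rmorphD.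
    rewrite (rmorphM _ (t ^+ 2)) (rmorphM _ m) !rmorphXn !sK.
    by rewrite [s t ^+ 3 + _]addrC [s t ^+ 2 * _]mulrC [s m * m]mulrC.
  have kE : m * s m = - ((t ^+ 3 + s t ^+ 3) / (t ^+ 2 * s t ^+ 2)) / k.
    by apply: (canRL (mulfK k0)); rewrite mulrC /k mulfVK.
  exists (k * t); first exact: mulf_neq0.
  rewrite rmorphM sk kE; field; by rewrite k0 t0 st0.
have st0 : s t != 0 by rewrite fmorph_eq0.
pose A := mx3 0 0 (s t)^-1 0 (- (s t / t)) (s t / t * s m) t (t * m) (s t / t).
have A1 : hadj A *m A = 1%:M.
  rewrite hadj_mx3 mul_mx3 mx3_1.
  rewrite !(rmorph0, rmorphN, rmorphM, fmorph_div, fmorphV, sK).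
  congr mx3; [ | | by rewrite -[RHS]tm; field; rewrite t0 st0 | ..];
    by field; rewrite ?t0 ?st0.
have [|g gG defg] := SU_antidiag_mx A1.
  by rewrite det_mx3; field; rewrite t0 st0.
have g3 : (g ^+ 3 = 1)%g by apply: (SU_trace0_order3 gG defg); ring.
have defxg := GL_mul x g; rewrite defx defg mul_mx3 in defxg.
have xg3 : ((x * g) ^+ 3 = 1)%g.
  apply: (SU_trace0_order3 (groupM xG gG) defxg).
  by rewrite defm; field; rewrite sK t0 a0 st0 sa0.
have gsteps : g \in <<killing_steps G x>>%g.
  by apply: order3_gen_killing_steps xG gG g3 xg3 _ _; apply: commute_sym; apply: commute1.
by apply: (SU_gen_killing_steps xG defx gG gsteps _ t0); rewrite defg mx3_e1.
Qed.

(** On the plane of [cv3 1 0 0] and [cv3 0 0 1], [g] has characteristic polynomial [X^2 + X + 1] and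
    [x * g] has [X^2 - X + 1], so their cubes there are 1 and -1. *)
Lemma transvection_gen_killing_steps x b : x \in G -> GLval x = utri 0 b ->
  b + s b = 0 -> 2%:R * b != 0 -> G \subset <<killing_steps G x>>%g.
Proof.
move=> xG defx sb; rewrite mulf_eq0 negb_or => /andP[n2 b0].
have {}sb : s b = - b by apply/eqP; rewrite -addr_eq0 addrC sb.
have [||g gG defg] := @SU_antidiag_mx (mx3 0 0 (- (b / 2%:R)) 0 1 0 (2%:R / b) 0 (- 1)).
- rewrite hadj_mx3 mul_mx3 mx3_1.
  rewrite !(rmorph0, rmorph1, rmorphN, rmorphM, fmorph_div, fmorphV, rmorph_nat, sb).
  by congr mx3; field; rewrite ?oppr_eq0 ?n2 ?b0.
- by rewrite det_mx3; field; rewrite ?n2 ?b0.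
have g3 : (g ^+ 3 = 1)%g by apply: (SU_trace0_order3 gG defg); ring.
pose z := ((x * g) ^+ 3)%g.
have defz : GLval z = mx3 (- 1) 0 0 0 1 0 0 0 (- 1).
  rewrite /z !expgS expg0 mulg1 !GL_mul defx defg !mul_mx3 rmorph0.
  by congr mx3; field; rewrite ?oppr_eq0 ?n2 ?b0.
have gsteps : g \in <<killing_steps G x>>%g.
  apply: order3_gen_killing_steps xG gG g3 (erefl z) _ _; apply: GLval_inj.
    by rewrite !(GL_mul z, GL_mul x) defz defx !mul_mx3 rmorph0; congr mx3; ring.
  by rewrite !(GL_mul z, GL_mul g) defz defg !mul_mx3; congr mx3; ring.
apply: (@SU_gen_killing_steps _ _ _ g 0 0 (2%:R / b) xG defx gG gsteps).
  by rewrite defg mx3_e1.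
by rewrite mulf_neq0 ?invr_neq0.
Qed.

Lemma p_elt_gen_killing_steps x : x \in G -> (p.-elt x)%g -> (x * x != 1)%g ->
  G \subset <<killing_steps G x>>%g.
Proof.
move=> xG px xx1.
have x1 : x != 1%g by apply: contraNneq xx1 => ->; rewrite mulg1.
have [h hG fixxh] := p_elt_fix_e1 xG px x1; apply: (gen_killing_stepsJ hG).
have xhG := groupJ xG hG.
have [a [b [defx ab]]] := SU_fix_e1 xhG fixxh.
have [a0|a0] := eqVneq a 0; last exact: regular_gen_killing_steps defx ab a0.
rewrite a0 in defx; rewrite a0 mul0r addr0 in ab.
apply: (transvection_gen_killing_steps xhG defx ab).
apply: contraNneq xx1 => b0; rewrite -(inj_eq (conjg_inj h)) conjMg conj1g.
apply/eqP/GLval_inj; rewrite GL_mul defx mul_utri mul0r.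
have -> : b - 0 + b = 2%:R * b by ring.
by rewrite b0 -[RHS]/(1%:M) mx3_1 /utri !addr0 rmorph0 oppr0.
Qed.

(** Take the conjugate [y] of [x] fixing [e1] and an involutory matrix [n] exchanging the two
    isotropic axes. If [y] commuted with [y ^ n], it would fix [y ^ n] applied to [e1], that is
    [cv3 1 (s a) b], which forces [a = b = 0]. *)
Lemma SU_p_elt_ncomm x : x \in G -> (p.-elt x)%g -> x != 1%g ->
  exists2 g, g \in G & ~ commute x (x ^ g)%g.
Proof.
move=> xG px x1; have [h hG fixxh] := p_elt_fix_e1 xG px x1.
have [a [b [defx ab0]]] := SU_fix_e1 (groupJ xG hG) fixxh.
have [||n nG defn] := @SU_antidiag_mx (mx3 0 0 1 0 (- 1) 0 1 0 0).
- rewrite hadj_mx3 mul_mx3 mx3_1 !(rmorph0, rmorphN, rmorph1).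
  by congr mx3; ring.
- by rewrite det_mx3; ring.
exists (h * n * h^-1)%g => [|com]; first by rewrite !groupM ?groupV.
have [y defy] : exists y, y = (x ^ h)%g by exists (x ^ h)%g.
rewrite -defy in fixxh defx.
have {}com : commute y (y ^ n)%g.
  rewrite defy -conjgM -(mulgKV h (h * n)%g) conjgM.
  by rewrite /commute -!conjMg com.
have nn : (n * n = 1)%g.
  apply: GLval_inj; rewrite GL_mul defn mul_mx3 -[RHS]/(1%:M) mx3_1.
  by congr mx3; ring.
have nV : (n^-1 = n)%g by apply/(mulgI n); rewrite mulgV nn.
have defyn : GLval (y ^ n)%g *m e1 = cv3 1 (s a) b.
  rewrite conjgE nV !GL_mul -!mulmxA defn defx mx3_e1 !mul_mx3_cv3.
  by congr cv3; ring.
have : GLval y *m cv3 1 (s a) b = cv3 1 (s a) b.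
  by rewrite -defyn mulmxA -GL_mul com GL_mul -mulmxA fixxh.
rewrite defx mul_mx3_cv3 => /cv3_inj[ab1 ab2 _].
have {}ab1 : a * s a + b * b = 0 by apply: (addrI 1); rewrite addr0 -[RHS]ab1; ring.
have {}ab2 : s a * b = 0.
  by apply: oppr_inj; rewrite oppr0; apply: (addrI (s a)); rewrite addr0 -[RHS]ab2; ring.
have [a0 b0] : a = 0 /\ b = 0.
  move: ab2 => /eqP; rewrite mulf_eq0 fmorph_eq0 => /orP[] /eqP z0.
    by move: ab1; rewrite z0 mul0r add0r => /eqP; rewrite mulf_eq0 orbb => /eqP.
  move: ab1; rewrite z0 mulr0 addr0 => /eqP.
  by rewrite mulf_eq0 fmorph_eq0 orbb => /eqP.
case/eqP: x1; apply: (conjg_inj h); rewrite conj1g -defy; apply: GLval_inj.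
by rewrite defx a0 b0 /utri rmorph0 oppr0 -[RHS]/(1%:M) mx3_1.
Qed.

(** * Involutions in characteristic 2 *)

Section Char2.

Hypothesis char2 : 2%:R = 0 :> F.

Let sqr1 (l : F) : l * l = 1 -> l = 1.
Proof.
move=> l1; apply/eqP; rewrite -subr_eq0 -[_ == 0]orbb -mulf_eq0; apply/eqP.
have -> : (l - 1) * (l - 1) = l * l - 1 - 2%:R * (l - 1) by ring.
by rewrite l1 char2 mul0r !subr0 subrr.
Qed.

(** In characteristic 2, [l * l = 1] gives [l = 1]; then the corner entry of the square of
    [utri a b] is [- (a * s a)], so [a = 0]. *)
Lemma involution_fix_point g l : g \in G -> (g * g = 1)%g ->
  GLval g *m e1 = cv3 l 0 0 -> l = 1 /\ exists b, GLval g = utri 0 b.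
Proof.
move=> gG gg1 defg; have le1 : cv3 l 0 0 = l *: e1.
  apply/matrixP=> i j; rewrite !mxE; case: i => [[|[|[|//]]] ?] /=;
  by rewrite ?mulr1 ?mulr0.
have l1 : l = 1.
  apply: sqr1; have : GLval (g * g)%g *m e1 = cv3 1 0 0 by rewrite gg1; apply: mul1mx.
  rewrite GL_mul -mulmxA defg le1 -scalemxAr defg => /matrixP/(_ 0 0).
  by rewrite !mxE.
split=> //; rewrite l1 in defg; have [a [b [defg' ab0]]] := SU_fix_e1 gG defg.
exists b; suff -> : 0 = a by [].
have := GL_mul g g; rewrite gg1 defg' mul_utri -[LHS]/(1%:M) mx3_1.
case/mx3_inj=> -[_ _ e13] _ _.
have /eqP : a * s a = 0.
  have -> : a * s a = 2%:R * b - (b - a * s a + b) by ring.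
  by rewrite char2 -e13; ring.
by rewrite mulf_eq0 fmorph_eq0 orbb => /eqP.
Qed.

(** The image of [t - 1] is the line of [e1], so [g] preserves that line. Commuting also makes the
    two outer diagonal entries of [g] equal, and unitarity then gives norm 1. *)
Lemma commute_transvection g t b : g \in G -> t \in G -> GLval t = utri 0 b -> b != 0 ->
  commute t g -> exists2 l, GLval g *m e1 = cv3 l 0 0 & s l * l = 1.
Proof.
move=> gG tG deft b0 com.
have [a [b' [c [d [e [f [h [i [j [defg gg1 _]]]]]]]]]] := SU_mx3P gG.
have := GL_mul t g; rewrite com GL_mul deft defg !mul_mx3.
case/mx3_inj=> -[E11 _ E13] _ _.
have h0 : h = 0.
  apply: (mulfI b0); have -> : b * h = (1 * a + 0 * d + b * h) - a by ring.
  by rewrite -E11; ring.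
have d0 : d = 0.
  apply: (@isotropic0 a); rewrite -h0; apply: (SU_isotropic gG).
  by rewrite defg mx3_e1.
have ja : j = a.
  apply: (mulfI b0); have -> : b * j = (1 * c + 0 * f + b * j) - c by ring.
  by rewrite -E13 rmorph0; ring.
move: gg1; rewrite defg hadj_mx3 mul_mx3 => /mx3_inj[_ _ [_ _ E33]].
exists a; first by rewrite mx3_e1 h0 d0.
by rewrite -[RHS]E33 h0 d0 !rmorph0 ja; ring.
Qed.

(** Commuting with [b] forces [a] and [c] to share its centre, and the matrices [utri 0 w] commute
    with each other. *)
Lemma involution_commute_trans a b c : a \in G -> b \in G -> c \in G ->
  (a * a = 1)%g -> (b * b = 1)%g -> (c * c = 1)%g -> (p.-elt b)%g -> b != 1%g ->
  commute a b -> commute b c -> commute a c.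
Proof.
move=> aG bG cG aa1 bb1 cc1 pb b1 ab bc.
have [h hG fixb] := p_elt_fix_e1 bG pb b1.
have invJ g : (g * g = 1 -> g ^ h * g ^ h = 1)%g by rewrite -conjMg => ->; rewrite conj1g.
have [_ [v defb]] := involution_fix_point (groupJ bG hG) (invJ b bb1) fixb.
have v0 : v != 0.
  apply: contraNneq b1 => v0; apply/eqP/(conjg_inj h)/GLval_inj.
  by rewrite defb v0 conj1g /utri rmorph0 oppr0 -[RHS]/(1%:M) mx3_1.
have defJ g : g \in G -> (g * g = 1)%g -> commute b g ->
    exists w, GLval (g ^ h)%g = utri 0 w.
  move=> gG gg1 bg.
  have bgh : commute (b ^ h) (g ^ h)%g by rewrite /commute -!conjMg bg.
  have [l defg _] := commute_transvection (groupJ gG hG) (groupJ bG hG) defb v0 bgh.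
  by case: (involution_fix_point (groupJ gG hG) (invJ g gg1) defg).
have [w defa] := defJ a aG aa1 (commute_sym ab).
have [w' defc] := defJ c cG cc1 bc.
apply: (conjg_inj h); rewrite !conjMg; apply: GLval_inj.
by rewrite !(GL_mul (a ^ h)%g, GL_mul (c ^ h)%g) defa defc !mul_utri; congr utri; ring.
Qed.

(* The product h = ab fixes the point of e1, with eigenvalue l of norm 1, and a inverts h, so
   f = a e1 has eigenvalue l^-1; if f is not on the line of e1 then (e1, f) <> 0 forces l = 1,
   and h would fix both e1 and f. *)
Lemma involution_commuteM a b c : a \in G -> b \in G -> c \in G ->
  (a * a = 1)%g -> (b * b = 1)%g -> (c * c = 1)%g -> (p.-elt c)%g -> c != 1%g -> a != b ->
  commute c (a * b)%g -> commute a b /\ commute c a.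
Proof.
move=> aG bG cG aa1 bb1 cc1 pc c1 ab cab.
have [g gG fixc] := p_elt_fix_e1 cG pc c1.
have invJ y : (y * y = 1 -> y ^ g * y ^ g = 1)%g by rewrite -conjMg => ->; rewrite conj1g.
have comJ y z : commute (y ^ g)%g (z ^ g)%g -> commute y z.
  by rewrite /commute -!conjMg => /conjg_inj.
suff [? ?] : commute (a ^ g)%g (b ^ g)%g /\ commute (c ^ g)%g (a ^ g)%g by split; apply: comJ.
have {cab} : commute (c ^ g)%g (a ^ g * b ^ g)%g by rewrite /commute -!conjMg cab.
have {ab} : (a ^ g != b ^ g)%g by rewrite (inj_eq (conjg_inj g)).
have {c1} : (c ^ g != 1)%g by rewrite conjg_eq1.
have {aG bG cG gG} := And3 (groupJ aG gG) (groupJ bG gG) (groupJ cG gG).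
have {aa1 bb1 cc1 invJ} := And3 (invJ a aa1) (invJ b bb1) (invJ c cc1).
move: {a b c comJ pc} (a ^ g)%g (b ^ g)%g (c ^ g)%g fixc => a b c fixc.
move=> [aa1 bb1 cc1] [aG bG cG] c1 ab cab.
have [_ [v defc]] := involution_fix_point cG cc1 fixc.
have v0 : v != 0.
  apply: contraNneq c1 => v0; apply/eqP/GLval_inj.
  by rewrite defc v0 /utri rmorph0 oppr0 -[RHS]/(1%:M) mx3_1.
have abG := groupM aG bG.
have [l defl ll] := commute_transvection abG cG defc v0 cab.
have le1 k : cv3 k 0 0 = k *: e1.
  apply/matrixP=> i j; rewrite !mxE; case: i => [[|[|[|//]]] ?] /=;
  by rewrite ?mulr1 ?mulr0.
have l0 : l != 0 by apply: contra_eq_neq ll => ->; rewrite mulr0 eq_sym oner_eq0.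
have commuting u w : GLval a *m e1 = cv3 u 0 0 -> GLval b *m e1 = cv3 w 0 0 ->
    commute a b /\ commute c a.
  move=> /(involution_fix_point aG aa1)[_ [x defa]].
  move=> /(involution_fix_point bG bb1)[_ [y defb]].
  split; apply: GLval_inj; rewrite !(GL_mul a, GL_mul b, GL_mul c) ?defa ?defb ?defc !mul_utri;
    by congr utri; ring.
have [f1 [f2 [f3 deff]]] := cv3P (GLval a *m e1).
have aV : (a^-1 = a)%g by apply: (mulgI a); rewrite mulgV aa1.
have be1 : GLval b *m e1 = l *: (GLval a *m e1).
  by rewrite scalemxAr -le1 -defl mulmxA -GL_mul mulgA aa1 mul1g.
(* If [f3 = 0], both [a] and [b] fix the point of [e1], which puts [a], [b] and [c] among the
   commuting matrices [utri 0 w]. *)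
have [f30|f30] := eqVneq f3 0.
  move: deff (SU_isotropic aG deff); rewrite f30 => deff /isotropic0 f20.
  rewrite f20 in deff; apply: (commuting f1 (l * f1)) => //.
  by rewrite be1 deff !le1 scalerA.
have abf : GLval (a * b)%g *m cv3 f1 f2 f3 = l^-1 *: cv3 f1 f2 f3.
  have ae1 : GLval a *m e1 = l^-1 *: (GLval b *m e1).
    by rewrite be1 scalerA mulVf // scale1r.
  by rewrite -deff {1}ae1 -scalemxAr mulmxA -GL_mul -mulgA bb1 mulg1.
have l1 : l = 1.
  have hE w : hform e1 (cv3 f1 f2 f3) = f3 /\ hform (l *: e1) (w *: cv3 f1 f2 f3) = s l * (w * f3).
    have -> : w *: cv3 f1 f2 f3 = cv3 (w * f1) (w * f2) (w * f3).
      by apply/matrixP=> i j; rewrite !mxE; case: i => [[|[|[|//]]] ?].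
    by rewrite -le1 !hform_cv3 rmorph0 rmorph1; split; ring.
  have := hform_SU e1 (cv3 f1 f2 f3) abG.
  rewrite defl le1 abf; have [-> ->] := hE l^-1 => slf.
  have sl : s l = l.
    apply: (mulIf f30); apply: (mulfI (invr_neq0 l0)).
    by rewrite mulrA [_ * s l]mulrC -mulrA slf mulKf.
  by apply: sqr1; rewrite -{1}sl.
have /SU_fix_e1[//|u [w [defab _]]] : GLval (a * b)%g *m e1 = e1 by rewrite defl l1.
(* A matrix [utri u w] fixing a vector with [f3 != 0] is trivial, so [a * b = 1], against
   [a != b]. *)
move: abf; rewrite defab l1 invr1 scale1r mul_mx3_cv3 => /cv3_inj[E1 E2 _].
have u0 : u = 0.
  have /eqP : - s u * f3 = 0 by apply: (addrI f2); rewrite addr0 -[RHS]E2; ring.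
  by rewrite mulf_eq0 (negPf f30) orbF oppr_eq0 fmorph_eq0 => /eqP.
have w0 : w = 0.
  have /eqP : w * f3 = 0 by apply: (addrI f1); rewrite addr0 -[RHS]E1 u0; ring.
  by rewrite mulf_eq0 (negPf f30) orbF => /eqP.
case/eqP: ab; rewrite -aV; apply: (mulgI a); rewrite mulgV; apply: GLval_inj.
by rewrite defab u0 w0 /utri rmorph0 oppr0 -[LHS]/(1%:M) mx3_1.
Qed.

End Char2.

End UnitaryGroup.

(** * Norms and traces in a finite field of order [q ^ 2] *)

Section FrobeniusFacts.

Variables (F : finFieldType) (p k : nat).
Hypotheses (p_pr : prime p) (cardF : #|F| = (p ^ k) ^ 2).
Let q := p ^ k.
Hypothesis q_gt1 : 1 < q.
Local Open Scope ring_scope.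

Lemma frobenius_rmorphism : p \in [pchar F] ->
  exists s : {rmorphism F -> F}, forall x, s x = x ^+ q.
Proof.
move=> charF; rewrite /q; elim: k => [|n [s sE]]; first by exists idfun.
exists (pFrobenius_aut charF \o s) => x /=.
by rewrite sE pFrobenius_autE -exprM expnSr.
Qed.

Lemma exists_nonroot (P : {poly F}) : P != 0 -> (size P <= #|F|)%N -> exists x, P.[x] != 0.
Proof.
move=> P0 szP; apply/existsP; apply: contraTT szP; rewrite negb_exists => /forallP P_0.
rewrite -ltnNge cardT; apply: max_poly_roots (enum_uniq _) => //.
by apply/allP=> x _; rewrite /root -[_ == _]negbK P_0.
Qed.

(** The unit group is cyclic of order [(q - 1) * (q + 1)], so its elements killed by [q - 1] are the
    powers with exponent [q + 1]. *)
Lemma finField_norm_surj x : x ^+ q = x -> exists y : F, y ^+ q.+1 = x.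
Proof.
have [-> _|x0 xq] := eqVneq x 0; first by exists 0; rewrite expr0n.
have [w defw] := cyclicP (field_unit_group_cyclic [set: {unit F}]).
have ow : #[w]%g = (q.-1 * q.+1)%N.
  by rewrite orderE -defw card_finField_unit cardF -/q -subn1 -[X in (_ - X)%N](exp1n 2) subn_sqr subn1 addn1.
have ux : x \is a GRing.unit by rewrite unitfE.
have /cycleP[i defx] : FinRing.unit F ux \in <[w]>%g by rewrite -defw inE.
have : (w ^+ (i * q.-1) = 1)%g.
  rewrite expgM -defx; apply: val_inj; rewrite FinRing.val_unitX /=.
  by apply: (mulIf x0); rewrite -exprSr prednK ?(ltnW q_gt1) // mul1r.
move/eqP; rewrite -order_dvdn ow mulnC dvdn_pmul2r -?subn1 ?subn_gt0 //.
case/dvdnP=> j defi; exists (FinRing.uval (w ^+ j)%g).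
by rewrite -FinRing.val_unitX -expgM -defi -defx.
Qed.

Lemma finField_trace_neq0 : exists t : F, t + t ^+ q != 0.
Proof.
have [||t] := @exists_nonroot ('X + 'X^q).
- apply/eqP=> /(congr1 (coefp 1)) /=.
  by rewrite coefD coefX coefXn coef0 (ltn_eqF q_gt1) addr0 => /eqP; rewrite oner_eq0.
- rewrite (leq_trans (size_polyD _ _)) // size_polyX size_polyXn geq_max cardF -/q.
  by rewrite (leq_trans q_gt1) ?leq_pmulr ?(ltnW q_gt1) //= -{1}(mul1n q) ltn_pmul2r // ltnW.
by rewrite hornerD hornerX hornerXn; exists t.
Qed.

(** For [q > 3] the polynomial [X^3 + X^(3q)] has degree below [q ^ 2], so it cannot vanish on all
    of [F]. For [q = 3] this bound fails, and [t = 1] works because 2 is non-zero. *)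
Lemma finField_cube_trace : q != 2%N ->
  exists2 t : F, t != 0 & t ^+ 3 + (t ^+ q) ^+ 3 != 0.
Proof.
move=> q2; have [q3|q3] := eqVneq q 3%N.
  exists 1; rewrite ?oner_eq0 // !expr1n -[1 + 1]/(2%:R).
  have charF : p \in [pchar F] by apply: (@card_finPcharP _ _ (k * 2)); rewrite // cardF expnM.
  rewrite -(dvdn_pcharf charF); apply/negP=> p2.
  have : (p %| 3)%N.
    by rewrite -q3 dvdn_exp // lt0n; apply: contraTneq q_gt1 => k0; rewrite /q k0.
  by rewrite -[3%N]/(2 + 1)%N dvdn_addr // dvdn1 => /eqP p1; have := p_pr; rewrite p1.
have q_gt3 : (3 < q)%N by rewrite ltn_neqAle eq_sym q3 ltn_neqAle eq_sym q2.
have [||t] := @exists_nonroot ('X^3 + 'X^(q * 3)).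
- apply/eqP=> /(congr1 (coefp 3)) /=; rewrite coefD !coefXn coef0.
  have -> : (3 == q * 3)%N = false by rewrite -{1}(mul1n 3%N) eqn_pmul2r // ltn_eqF.
  by rewrite addr0 => /eqP; rewrite oner_eq0.
- rewrite (leq_trans (size_polyD _ _)) // !size_polyXn geq_max cardF -/q.
  have lt : (q * 3 < q ^ 2)%N by rewrite ltn_pmul2l // ltnW.
  by rewrite lt (leq_ltn_trans _ lt) // -{1}(mul1n 3%N) leq_pmul2r // ltnW.
rewrite hornerD !hornerXn exprM => t0; exists t => //.
by apply: contraNneq t0 => ->; rewrite (expr0n _ q) (gtn_eqF (ltnW q_gt1)) !expr0n addr0.
Qed.

End FrobeniusFacts.

(** * From the antidiagonal form back to the standard one, and to the quotient *)

Lemma SU3_conj (F : finFieldType) (q : nat) (s : {rmorphism F -> F}) (h : {'GL_3[F]}) :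
  (forall x, s x = x ^+ q)%R ->
  ((map_mx s (GLval h))^T *m GLval h = antidiag3 F)%R ->
  SU3 F q = (SU_antidiag s :^ h^-1)%g.
Proof.
move=> sE hh; apply/setP=> g; rewrite mem_conjgV !inE.
have -> : frobq_mx q (GLval g) = map_mx s (GLval g).
  by apply/matrixP=> i j; rewrite !mxE sE.
have -> : GLval (g ^ h)%g = (GLval h^-1%g *m GLval g *m GLval h)%R.
  by rewrite conjgE !GL_mul mulmxA.
have hV : (GLval h^-1%g *m GLval h = 1%:M)%R by rewrite -GL_mul mulVg.
have hV' : (GLval h *m GLval h^-1%g = 1%:M)%R by rewrite -GL_mul mulgV.
rewrite !det_mulmx [(\det _ * \det (GLval g))%R]mulrC -mulrA -det_mulmx hV det1 mulr1.
congr andb.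
set A := GLval g; set B := GLval h in hh hV hV' *; set B' := GLval _ in hV hV' *.
(* By [hh], this product is a left inverse of [B]; it reduces the antidiagonal condition on [g ^ h]
   to the standard one on [g], conjugated by [B]. *)
have JB : (antidiag3 F *m (map_mx s B)^T = B')%R.
  by rewrite -[LHS]mulmx1 -hV' mulmxA -(mulmxA _ _ B) hh antidiag3K mul1mx.
have hadjB : (hadj s B = B' *m antidiag3 F)%R by rewrite /hadj JB.
have hadjB' : (hadj s B' = antidiag3 F *m B)%R.
  have : (hadj s B' *m (B' *m antidiag3 F) = 1%:M)%R by rewrite -hadjB -hadjM hV' hadj1.
  move/(congr1 (mulmx^~ (antidiag3 F *m B)%R)); rewrite mul1mx => <-.
  rewrite -(mulmxA (hadj s B')) -(mulmxA B') (mulmxA (antidiag3 F) _ B) antidiag3K.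
  by rewrite mul1mx hV mulmx1.
rewrite !hadjM hadjB hadjB' /hadj.
have -> : (B' *m antidiag3 F *m (antidiag3 F *m (map_mx s A)^T *m antidiag3 F *m (antidiag3 F *m B))
    *m (B' *m A *m B) = B' *m ((map_mx s A)^T *m A) *m B)%R.
  rewrite -!mulmxA !(mulmxA (antidiag3 F) (antidiag3 F)) antidiag3K !mul1mx.
  by rewrite (mulmxA B B') hV' mul1mx.
apply/eqP/eqP=> [->|M1]; first by rewrite mulmx1 hV.
have : (B *m (B' *m ((map_mx s A)^T *m A) *m B) *m B' = 1%:M)%R by rewrite M1 mulmx1 hV'.
by rewrite !mulmxA hV' mul1mx -mulmxA hV' mulmx1.
Qed.

(** The columns of [A] are the isotropic vector [(1, c, 0)], the unit vector [(0, 0, 1)] orthogonal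
    to it, and [(1 + r, r c, 0)], which pairs to 1 with the first and is isotropic because
    [r + s r = - 1]. *)
Lemma unitary_antidiag3_basis (F : finFieldType) (s : {rmorphism F -> F}) (c r : F) :
  involutive s -> (c * s c = - 1)%R -> (r + s r = - 1)%R ->
  exists h : {'GL_3[F]}, ((map_mx s (GLval h))^T *m GLval h = antidiag3 F)%R.
Proof.
move=> sK cc rr; pose A : 'M[F]_3 := (mx3 1 0 (1 + r) c 0 (r * c) 0 1 0)%R.
have AA : ((map_mx s A)^T *m A = antidiag3 F)%R.
  have -> : (map_mx s A)^T%R = (mx3 1 (s c) 0 0 0 1 (1 + s r) (s r * s c) 0)%R.
    apply/matrixP=> i j; rewrite !mxE.
    by case: i j => [[|[|[|//]]] ?] [[|[|[|//]]] ?] /=;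
      rewrite ?rmorphD ?rmorphM ?rmorph0 ?rmorph1.
  have scc : (s c * c = - 1)%R by rewrite mulrC.
  have sr : (s r = - 1 - r)%R by rewrite -rr addrC addKr.
  by rewrite mul_mx3 sr; congr mx3; ring: scc.
have uA : A \is a GRing.unit.
  have /mulmx1_unit[_] : ((antidiag3 F *m (map_mx s A)^T) *m A = 1%:M)%R.
    by rewrite -mulmxA AA antidiag3K.
  by [].
by exists (FinRing.unit _ uA : {'GL_3[F]}).
Qed.

Theorem theorem4p13 (F : finFieldType) (p k q : nat) :
  prime p -> 0 < k -> q = p ^ k -> q != 2 -> #|F| = q ^ 2 ->
  (forall C : {set {'GL_3[F]}}, unipotent_class_claim p (SU3 F q) C) /\
  (forall C : {set coset_of 'Z(SU3 F q)}, unipotent_class_claim p (PSU3 F q) C).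
Proof.
move=> p_pr k_gt0 defq q2 cardF.
have q_gt1 : 1 < q by rewrite defq -(exp1n k) ltn_exp2r // prime_gt1.
have charF : p \in [pchar F]%R.
  by apply: (@card_finPcharP _ _ (k * 2)) => //; rewrite cardF defq expnM.
have [s] := frobenius_rmorphism k charF; rewrite -defq => sE.
have sK : involutive s by move=> x; rewrite !sE -exprM -[q * q]/(q ^ 2) -cardF expf_card.
have cardF' : #|F| = (p ^ k) ^ 2 by rewrite cardF defq.
have q_gt1' : 1 < p ^ k by rewrite -defq.
have nsurj x : s x = x -> exists y, (y * s y = x)%R.
  rewrite sE defq => /(finField_norm_surj cardF' q_gt1')[y <-].
  by exists y; rewrite sE defq exprS.
have cubet : exists2 t : F, (t != 0)%R & (t ^+ 3 + s t ^+ 3 != 0)%R.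
  have [|t t0] := finField_cube_trace p_pr cardF' q_gt1'; first by rewrite -defq.
  by rewrite -defq -sE; exists t.
have [c cc] : exists c, (c * s c = - 1)%R by apply: nsurj; rewrite rmorphN rmorph1.
have [r rr] : exists r, (r + s r = - 1)%R.
  have [t] := finField_trace_neq0 cardF' q_gt1'; rewrite -defq -sE => t0.
  (* The denominator is fixed by [s], so the fraction has trace 1. *)
  exists (- (t / (t + s t)))%R.
  rewrite rmorphN fmorph_div rmorphD sK [(s t + t)%R]addrC -opprD -mulrDl.
  by rewrite mulfV.
have [h hh] := unitary_antidiag3_basis sK cc rr.
pose G := SU_antidiag_group s.
(* Both groups are images of [G] with central kernel: one by conjugation by [h^-1], the other by
   this conjugation followed by the quotient map. *)
have sub_fG (rT : finGroupType) (f : {morphism G >-> rT}) :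
    {in G, forall z, f z = 1%g -> z \in 'Z(G)%g} ->
    forall C, unipotent_class_claim p (f @* G)%g C.
  move=> kerf C; apply: unipotent_class_claim_morphim => //.
  - exact: p_elt_gen_killing_steps.
  - move=> p2 a b c' aG bG cG; apply: involution_commuteM => //.
    by rewrite -p2 pcharf0.
  - move=> p2 a b c' aG bG cG; apply: involution_commute_trans => //.
    by rewrite -p2 pcharf0.
  exact: SU_p_elt_ncomm.
have SUE := SU3_conj sE hh.
pose H := (G :^ h^-1)%G.
rewrite /PSU3 (SUE : SU3 F q = H).
split=> [|].
  have imf : (conjgm_morphism G h^-1%g @* G = H)%g by rewrite morphim_conj setIid.
  rewrite -imf; apply: sub_fG => z zG /eqP; rewrite /= conjg_eq1 => /eqP->.
  exact: (group1 'Z(G)%G).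
have sHN : H \subset 'N('Z(H))%g by rewrite normal_norm ?center_normal.
have memH x : x \in G -> (x ^ h^-1)%g \in H by rewrite memJ_conjg.
have fM : {in G &, {morph (fun x => coset 'Z(H) (x ^ h^-1)) : x y / x * y}}%g.
  by move=> x y xG yG /=; rewrite conjMg morphM ?(subsetP sHN) ?memH.
have imf : (Morphism fM @* G = H / 'Z(H))%g.
  rewrite morphimEdom quotientE morphimEsub // -imset_comp.
  exact: eq_imset.
rewrite -imf; apply: sub_fG => z zG /= cz1.
have : (z ^ h^-1)%g \in 'Z(H)%g by apply: coset_idr; rewrite ?(subsetP sHN) ?memH.
by rewrite /= /center centJ -conjIg memJ_conjg.
Qed.
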